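(* Let $G$ be a connected weighted graph on $n$ vertices, where each edge weight is a positive definite matrix of order $s$. Let $R$ be the resistance matrix of $G$ and $L$ its Laplacian matrix. Let $\mu_1\ge\mu_2\ge\cdots\ge\mu_{ns}$ be the eigenvalues of $R$ and $\lambda_1\ge\cdots\ge\lambda_{ns-s}>\lambda_{ns-s+1}=\cdots=\lambda_{ns}=0$ the eigenvalues of $L$. Then $$\mu_{s+i}\le-\frac{2}{\lambda_i}\le\mu_i\quad\text{for } i=1,2,\dots,ns-s.$$
   Context: $G$ is a simple graph with vertex set $\{1,\dots,n\}$; each edge $\{i,j\}$ carries a weight $W_{i,j}=W_{j,i}$, a real $s\times s$ positive definite matrix; $j\sim i$ means adjacency. The Laplacian $L$ is the $ns\times ns$ block matrix with $(i,i)$ block $\sum_{j\sim i}W_{i,j}^{-1}$, $(i,j)$ block ($i\ne j$) equal to $-W_{i,j}^{-1}$ if $i\sim j$ and $0$ otherwise. Writing $K_{i,j}$ for the $s\times s$ blocks of the Moore--Penrose inverse $L^\dagger$, the resistance matrix $R$ is the $ns\times ns$ block matrix with blocks $R_{i,j}=K_{i,i}+K_{j,j}-2K_{i,j}$. *)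

(* Defs.v *)
From mathcomp Require Import all_boot all_order all_algebra.

Set Implicit Arguments.
Unset Strict Implicit.
Unset Printing Implicit Defensive.

Import Order.TTheory GRing.Theory Num.Theory.

Local Open Scope ring_scope.

Definition connected_graph (V : finType) (e : rel V) : Prop :=
  forall x y, connect e x y.

Definition posdefmx (R : realFieldType) (n : nat) (A : 'M[R]_n) : Prop :=
  A^T = A /\ forall x : 'cV[R]_n, x != 0 -> 0 < (x^T *m A *m x) 0 0.

Section MoorePenrose.

Variable R : realFieldType.

(* The four Penrose equations, in the real case. *)
Definition is_mpinv m n (A : 'M[R]_(m, n)) (X : 'M[R]_(n, m)) : Prop :=
  [/\ A *m X *m A = A,
      X *m A *m X = X,
      (A *m X)^T = A *m X
    & (X *m A)^T = X *m A].

(* Explicit inverse from the full rank factorization A = B *m C with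
   B = col_base A and C = row_base A; mxalgebra's pinvmx is a generalized
   inverse that need not satisfy the Penrose equations. *)
Definition mpinv m n (A : 'M[R]_(m, n)) : 'M[R]_(n, m) :=
  let B := col_base A in
  let C := row_base A in
  C^T *m invmx (C *m C^T) *m (invmx (B^T *m B) *m B^T).

Lemma row_free_gram_unit m n (C : 'M[R]_(m, n)) :
  row_free C -> C *m C^T \in unitmx.
Proof.
move=> Cfree; rewrite -row_free_unit; apply: inj_row_free => v v0.
apply: (row_free_inj Cfree); rewrite mul0mx.
have: v *m C *m (v *m C)^T = 0.
  by rewrite trmx_mul mulmxA -(mulmxA v) v0 mul0mx.
move: (v *m C) => w /matrixP/(_ 0 0); rewrite !mxE => /eqP.
under eq_bigr do rewrite mxE -expr2.
rewrite psumr_eq0 => [/allP sq0 | j _]; last exact: sqr_ge0.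
apply/rowP => j; rewrite mxE; apply/eqP; rewrite -sqrf_eq0.
exact: sq0 (mem_index_enum j).
Qed.

Lemma full_rank_mpinv m n r (B : 'M[R]_(m, r)) (C : 'M[R]_(r, n)) :
    row_full B -> row_free C ->
  is_mpinv (B *m C)
    (C^T *m invmx (C *m C^T) *m (invmx (B^T *m B) *m B^T)).
Proof.
move=> Bfull Cfree.
have uC : C *m C^T \in unitmx by apply: row_free_gram_unit.
have uB : B^T *m B \in unitmx.
  rewrite -{2}[B]trmxK row_free_gram_unit //.
  by rewrite /row_free mxrank_tr; apply: Bfull.
set X := _ *m _ *m _.
have AX : B *m C *m X = B *m invmx (B^T *m B) *m B^T.
  by rewrite /X -!mulmxA (mulmxA C) (mulKVmx uC).
have XA : X *m (B *m C) = C^T *m invmx (C *m C^T) *m C.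
  by rewrite /X -!mulmxA (mulmxA B^T) (mulKmx uB).
split.
- by rewrite AX -!mulmxA (mulmxA B^T) (mulKmx uB).
- by rewrite XA /X -!mulmxA (mulmxA C) (mulKVmx uC).
- by rewrite AX !trmx_mul trmx_inv trmx_mul !trmxK mulmxA.
- by rewrite XA !trmx_mul trmx_inv trmx_mul !trmxK mulmxA.
Qed.

Lemma mpinvP m n (A : 'M[R]_(m, n)) : is_mpinv A (mpinv A).
Proof.
have := full_rank_mpinv (col_base_full A) (row_base_free A).
by rewrite mulmx_base.
Qed.

Lemma is_mpinv_uniq m n (A : 'M[R]_(m, n)) (X Y : 'M[R]_(n, m)) :
  is_mpinv A X -> is_mpinv A Y -> X = Y.
Proof.
move=> [AXA XAX sAX sXA] [AYA YAY sAY sYA].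
have eqAX : A *m X = A *m Y.
  by rewrite -sAX -{1}AYA -mulmxA trmx_mul sAX sAY mulmxA AXA.
have eqXA : X *m A = Y *m A.
  by rewrite -sXA -{1}AYA -mulmxA mulmxA trmx_mul sYA sXA -mulmxA (mulmxA A) AXA.
by rewrite -XAX eqXA -mulmxA eqAX mulmxA YAY.
Qed.

End MoorePenrose.

Section BlockMatrices.

Variables (R : realFieldType) (n s : nat).

(* The dimension \sum_(i < n) s is n * s; it is kept in this form, required by
   mxblock and submxblock, so that no casts are needed. *)
Definition laplacian (e : rel 'I_n) (W : 'I_n -> 'I_n -> 'M[R]_s) :
    'M[R]_(\sum_(i < n) s) :=
  \mxblock_(i < n, j < n)
    (if i == j then \sum_(k | e i k) invmx (W i k)
     else if e i j then - invmx (W i j)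
     else 0).

Definition resistance (e : rel 'I_n) (W : 'I_n -> 'I_n -> 'M[R]_s) :
    'M[R]_(\sum_(i < n) s) :=
  let K i j := submxblock (mpinv (laplacian e W)) i j in
  \mxblock_(i < n, j < n) (K i i + K j j - K i j *+ 2).

End BlockMatrices.

(* mu lists all the eigenvalues of A, with algebraic multiplicity, in
   nonincreasing order; in particular size mu = n. *)
Definition eigenvalues_desc (R : realFieldType) (n : nat) (A : 'M[R]_n)
    (mu : seq R) : Prop :=
  sorted >=%R mu /\ char_poly A = \prod_(x <- mu) ('X - x%:P).

(* Main.v *)
(** The proof compares quadratic forms. Write [E] for the block column of
    identity matrices. Connectedness and positivity of the weights make [L]
    positive semidefinite with kernel the column space of [E], of dimension
    [s]. Since [R = D E^T + E D^T - 2 L^+] with [D] the block column of the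
    [K_ii], the forms of [R] and [- 2 L^+] agree on the orthogonal complement
    of [E], where the eigenvalues of [- 2 L^+] are the [- 2 / lambda_i].
    As that complement has codimension [s], comparing the two forms on
    intersections of spans of eigenvectors (Cauchy interlacing) gives both
    inequalities. *)
Require Import Defs.
From mathcomp Require Import all_boot all_order all_algebra.
From mathcomp Require Import reals zify.

Set Implicit Arguments.
Unset Strict Implicit.
Unset Printing Implicit Defensive.

Import Order.TTheory GRing.Theory Num.Theory.

Local Open Scope ring_scope.

(** * Orthogonal diagonalisation of real symmetric matrices *)

Lemma mxdot_eq0 (R : realDomainType) n (v : 'rV[R]_n) :
  ((v *m v^T) 0 0 == 0) = (v == 0).
Proof.
apply/eqP/eqP => [|->]; last by rewrite mul0mx mxE.
rewrite mxE; under eq_bigr do rewrite mxE -expr2.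
move=> /eqP; rewrite psumr_eq0 => [/allP sq0 | j _]; last exact: sqr_ge0.
apply/rowP => j; rewrite mxE; apply/eqP; rewrite -sqrf_eq0.
exact: sq0 (mem_index_enum j).
Qed.

Lemma mxdot_ge0 (R : realDomainType) n (v : 'rV[R]_n) : 0 <= (v *m v^T) 0 0.
Proof. by rewrite mxE sumr_ge0 // => j _; rewrite mxE -expr2 sqr_ge0. Qed.

Lemma householder_involutive (F : fieldType) n (w : 'rV[F]_n) (c : F) :
    w *m w^T = c%:M -> c != 0 ->
  let H := 1%:M - (2 / c) *: (w^T *m w) in H *m H = 1%:M.
Proof.
move=> ww c0 /=; rewrite mulmxBl mul1mx mulmxBr mulmx1 -scalemxAl -scalemxAr.
rewrite mulmxA -(mulmxA w^T w) ww mul_mx_scalar -scalemxAl !scalerA.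
rewrite divfK // [2 / c * 2]mulr_natr mulr2n scalerDl opprB addrA.
by rewrite addrA addrK subrK.
Qed.

(* The Householder reflection exchanging the first basis vector and v. *)
Lemma orthogonal_first_row (F : realFieldType) n (v : 'rV[F]_n.+1) :
  v *m v^T = 1%:M -> exists2 H : 'M[F]_n.+1, H *m H^T = 1%:M & row 0 H = v.
Proof.
move=> vv1; pose e0 : 'rV[F]_n.+1 := delta_mx 0 0.
have [-> | ne_v] := eqVneq v e0.
  by exists 1%:M; rewrite ?trmx1 ?mulmx1 // row1.
pose w := v - e0; pose c := (w *m w^T) 0 0.
pose H := 1%:M - (2 / c) *: (w^T *m w).
have c0 : c != 0 by rewrite mxdot_eq0 subr_eq0.
have ee : e0 *m e0^T = 1%:M.
  by rewrite trmx_delta mul_delta_mx; apply/matrixP => i j; rewrite !mxE !ord1.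
have ww : w *m w^T = c%:M by rewrite [LHS]mx11_scalar.
have ve : v *m e0^T = (v 0 0)%:M.
  by rewrite trmx_delta -colE [LHS]mx11_scalar mxE.
have ev : e0 *m v^T = (v 0 0)%:M by rewrite -[RHS]tr_scalar_mx -ve trmx_mul trmxK.
(* Both [v] and [e0] are unit vectors, so [c = |v - e0|^2] depends only on their inner product
   [v 0 0]. This makes the coefficient of [w] in [row 0 H] equal to 1, and [e0 + w = v]. *)
have cE : c = 2 * (1 - v 0 0).
  rewrite /c /w raddfB /= mulmxBl !mulmxBr vv1 ve ev ee !mxE !eqxx !mulr1n.
  by rewrite opprB mulrBr mulr1 mulr2n mulrDl mul1r opprD addrACA.
have HT : H^T = H.
  by rewrite /H raddfB /= trmx1 linearZ /= trmx_mul trmxK.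
exists H.
  by rewrite HT householder_involutive.
have ew : e0 *m w^T = (v 0 0 - 1)%:M.
  by rewrite linearB /= mulmxBr ev ee raddfB.
rewrite rowE -/e0 mulmxBr mulmx1 -scalemxAr mulmxA ew mul_scalar_mx scalerA.
have -> : 2 / c * (v 0 0 - 1) = -1 :> F.
  by rewrite mulrAC -opprB mulrN -cE mulNr divff.
by rewrite scaleN1r opprK addrC subrK.
Qed.

Lemma char_poly_conj_orthogonal (F : fieldType) n (A H : 'M[F]_n) :
  H *m H^T = 1%:M -> char_poly (H *m A *m H^T) = char_poly A.
Proof.
move=> HH; pose h := map_mx (@polyC F) H.
have hh : h *m h^T = 1%:M by rewrite /h map_trmx -map_mxM HH map_mx1.
have E : char_poly_mx (H *m A *m H^T) = h *m char_poly_mx A *m h^T.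
  rewrite /char_poly_mx mulmxBr mulmxBl mul_mx_scalar -scalemxAl hh scalemx1.
  by rewrite !map_mxM /h map_trmx.
by rewrite /char_poly E !det_mulmx mulrAC -det_mulmx hh det1 mul1r.
Qed.

(** Deflation by induction on the size: a reflection whose first row is a unit eigenvector for the
    head [a] of [mu] splits off [a]. Cancelling ['X - a%:P] shows that the remaining block has the
    tail of [mu] as spectrum, so the diagonal keeps the order of [mu]. *)
Lemma symmetric_spectral (R : rcfType) n (A : 'M[R]_n) (mu : seq R) :
    A^T = A -> char_poly A = \prod_(x <- mu) ('X - x%:P) ->
  exists2 P : 'M[R]_n, P *m P^T = 1%:M
    & A = P^T *m diag_mx (\row_i mu`_i) *m P.
Proof.
elim: n A mu => [|n IHn] A mu sA.
  by exists 1%:M; apply/matrixP => -[].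
case: mu => [|a mu] chA.
  by have := size_char_poly A; rewrite chA big_nil size_poly1.
have /eigenvalueP[v vA v0] : eigenvalue A a.
  by rewrite eigenvalue_root_char chA big_cons rootM root_XsubC eqxx.
pose c := (v *m v^T) 0 0; pose u := (Num.sqrt c)^-1 *: v.
have c_gt0 : 0 < c by rewrite lt_neqAle eq_sym mxdot_eq0 v0 mxdot_ge0.
have uu : u *m u^T = 1%:M.
  rewrite [LHS]mx11_scalar /u linearZ /= -scalemxAl -scalemxAr scalerA mxE.
  by rewrite -/c -invfM -expr2 sqr_sqrtr ?ltW // mulVf ?gt_eqF.
have uA : u *m A = a *: u by rewrite -scalemxAl vA !scalerA mulrC.
have [H HH rH] := orthogonal_first_row uu.
have HH' : H^T *m H = 1%:M by apply: mulmx1C.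
pose B : 'M[R]_(1 + n) := H *m A *m H^T.
have sB : B^T = B by rewrite /B !trmx_mul trmxK sA mulmxA.
have rB : row 0 B = a *: row 0 1%:M.
  by rewrite !row_mul rH uA -scalemxAl -rH -row_mul HH.
(* The first row of [B] is [a] times the first basis vector; symmetry then clears the first column
   too. *)
have BE : B = block_mx a%:M 0 0 (drsubmx B).
  have urB : ursubmx B = 0.
    apply/matrixP => i j; rewrite ord1 !mxE.
    have /rowP/(_ (rshift 1 j)) := rB.
    rewrite !mxE (_ : lshift n 0 = 0); last exact: val_inj.
    by move=> ->; rewrite -val_eqE /= mulr0n mulr0.
  rewrite -{1}[B]submxK urB; congr block_mx.
    rewrite [LHS]mx11_scalar !mxE (_ : lshift n 0 = 0); last exact: val_inj.
    by have /rowP/(_ 0) := rB; rewrite !mxE eqxx mulr1 => ->.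
  by rewrite -sB -trmx_ursub urB trmx0.
have [Q QQ DE] : exists2 Q : 'M[R]_n, Q *m Q^T = 1%:M
    & drsubmx B = Q^T *m diag_mx (\row_i mu`_i) *m Q.
  apply: IHn; first by rewrite trmx_drsub sB.
  have : char_poly B = \prod_(x <- a :: mu) ('X - x%:P).
    by rewrite /B char_poly_conj_orthogonal.
  rewrite {1}BE /char_poly char_block_diag_mx det_ublock big_cons det_mx11 !mxE.
  by rewrite eqxx !mulr1n; move/(mulfI (negbT (polyXsubC_eq0 a))).
pose P : 'M[R]_(1 + n) := block_mx 1%:M 0 0 Q.
have PP : P *m P^T = 1%:M.
  rewrite /P tr_block_mx mulmx_block !trmx0 trmx1 !mulmx0 !mul0mx !addr0 add0r.
  by rewrite mulmx1 QQ -scalar_mx_block.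
exists (P *m H).
  by rewrite trmx_mul mulmxA -(mulmxA P) HH mulmx1.
have -> : diag_mx (\row_(i < n.+1) (a :: mu)`_i) =
    block_mx a%:M 0 0 (diag_mx (\row_i mu`_i)) :> 'M_(1 + n).
  rewrite -diag_const_mx -diag_mx_row; congr diag_mx.
  apply/rowP => i; rewrite !mxE; case: splitP => k ik; rewrite mxE.
    by rewrite ik ord1.
  by rewrite ik.
have -> : (P *m H)^T *m block_mx a%:M 0 0 (diag_mx (\row_i mu`_i)) *m (P *m H) =
    H^T *m (P^T *m block_mx a%:M 0 0 (diag_mx (\row_i mu`_i)) *m P) *m H.
  by rewrite trmx_mul !mulmxA.
have -> : P^T *m block_mx a%:M 0 0 (diag_mx (\row_i mu`_i)) *m P = B.
  rewrite BE DE /P tr_block_mx !mulmx_block !trmx0 trmx1.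
  by rewrite !(mulmx0, mul0mx, addr0, add0r, mulmx1, mul1mx).
by rewrite /B !mulmxA HH' mul1mx -mulmxA HH' mulmx1.
Qed.

(** * Dimension counts and comparison of quadratic forms *)

Lemma exists_ker (F : fieldType) m n (M : 'M[F]_(m, n)) :
  (n < m)%N -> exists2 v : 'rV_m, v != 0 & v *m M = 0.
Proof.
move=> ltnm; have /rowV0Pn[v /sub_kermxP vM v0] : kermx M != 0.
  by rewrite kermx_eq0 /row_free ltn_eqF // (leq_ltn_trans (rank_leq_col M)).
by exists v.
Qed.

Lemma colsub_enum_eq0 (F : fieldType) m n (v : 'rV[F]_m) (M : 'M[F]_(m, n))
    (I : {set 'I_n}) :
  v *m colsub (enum_val : 'I_#|I| -> 'I_n) M = 0 ->
  forall i, i \in I -> (v *m M) 0 i = 0.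
Proof.
rewrite mulmx_colsub => /rowP vM i iI.
by have := vM (enum_rank_in iI i); rewrite !mxE enum_rankK_in.
Qed.

(** The selected columns of [A] and [B], side by side, form a matrix with fewer columns than rows,
    which has a nonzero left kernel. *)
Lemma exists_vanishing (F : fieldType) m n p (A : 'M[F]_(m, n)) (B : 'M[F]_(m, p))
    (I : {set 'I_n}) (J : {set 'I_p}) :
  (#|I| + #|J| < m)%N -> exists2 v : 'rV_m, v != 0 &
    (forall i, i \in I -> (v *m A) 0 i = 0) /\
    (forall j, j \in J -> (v *m B) 0 j = 0).
Proof.
move=> ltm; pose A' := colsub (enum_val : 'I_#|I| -> 'I_n) A.
pose B' := colsub (enum_val : 'I_#|J| -> 'I_p) B.
have [v v0] := exists_ker (row_mx A' B') ltm.
rewrite mul_mx_row => /eqP; rewrite row_mx_eq0 => /andP[/eqP vA /eqP vB].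
by exists v => //; split; apply: colsub_enum_eq0.
Qed.

Lemma card_ord_lt n k : (k <= n)%N -> #|[set i : 'I_n | (i < k)%N]| = k.
Proof.
move=> lekn; rewrite -sum1_card.
under eq_bigl do rewrite inE.
by rewrite (big_ord_narrow lekn) sum1_card card_ord.
Qed.

Lemma card_ord_ge n k : (k <= n)%N -> #|[set i : 'I_n | (k <= i)%N]| = (n - k)%N.
Proof.
move=> lekn; apply: (@addnI k); rewrite subnKC // -[RHS]card_ord.
rewrite -(cardsC [set i : 'I_n | (i < k)%N]) card_ord_lt //; congr addn.
by apply: eq_card => i; rewrite !inE -leqNgt.
Qed.

Lemma qform_diag (R : comNzRingType) n (P : 'M[R]_n) (d : 'rV[R]_n) (x : 'rV[R]_n) :
  (x *m (P^T *m diag_mx d *m P) *m x^T) 0 0 =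
  \sum_i d 0 i * (x *m P^T) 0 i ^+ 2.
Proof.
have -> : x *m (P^T *m diag_mx d *m P) *m x^T =
    (x *m P^T) *m diag_mx d *m (x *m P^T)^T.
  by rewrite trmx_mul trmxK !mulmxA.
move: (x *m P^T) => c; rewrite mul_mx_diag mxE; apply: eq_bigr => i _.
by rewrite !mxE [c 0 i * _]mulrC -mulrA -expr2.
Qed.

Lemma orthogonal_dot (R : comNzRingType) n (P : 'M[R]_n) (x : 'rV[R]_n) :
  P *m P^T = 1%:M -> (x *m x^T) 0 0 = \sum_i (x *m P^T) 0 i ^+ 2.
Proof.
move=> PP.
have -> : x *m x^T = x *m (P^T *m diag_mx (const_mx 1) *m P) *m x^T.
  by rewrite diag_const_mx mulmx1 (mulmx1C PP) mulmx1.
by rewrite qform_diag; apply: eq_bigr => i _; rewrite mxE mul1r.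
Qed.

(* The codimensions [#|I|] and [#|J|] are too small for the two spans of
   eigenvectors to meet only in 0: compare the forms at a common vector. *)
Lemma spectral_compare (R : realFieldType) n (P Q : 'M[R]_n) (d f : 'rV[R]_n)
    (I J : {set 'I_n}) (a b : R) :
    P *m P^T = 1%:M -> Q *m Q^T = 1%:M -> (#|I| + #|J| < n)%N ->
    (forall i, i \notin I -> a <= d 0 i) ->
    (forall j, j \notin J -> f 0 j <= b) ->
    (forall x : 'rV_n, (forall i, i \in I -> (x *m P^T) 0 i = 0) ->
      (forall j, j \in J -> (x *m Q^T) 0 j = 0) ->
      (x *m (P^T *m diag_mx d *m P) *m x^T) 0 0 <=
      (x *m (Q^T *m diag_mx f *m Q) *m x^T) 0 0) ->
  a <= b.
Proof.
move=> PP QQ ltn ad fb le_qf.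
have [x x0 [xI xJ]] := exists_vanishing P^T Q^T ltn.
have xx : 0 < (x *m x^T) 0 0 by rewrite lt_neqAle eq_sym mxdot_eq0 x0 mxdot_ge0.
(* With [|x|^2 > 0], the chain is [a |x|^2 <= form of d <= form of f <= b |x|^2], each norm being
   expanded in the matching eigenbasis. *)
rewrite -(ler_pM2r xx) {1}(orthogonal_dot _ PP) (orthogonal_dot _ QQ).
apply: le_trans (le_trans (le_qf x xI xJ) _); rewrite qform_diag mulr_sumr.
  apply: ler_sum => i _; have [/xI -> | iI] := boolP (i \in I).
    by rewrite expr0n !mulr0.
  by rewrite ler_wpM2r ?sqr_ge0 ?ad.
apply: ler_sum => i _; have [/xJ -> | iJ] := boolP (i \in J).
  by rewrite expr0n !mulr0.
by rewrite ler_wpM2r ?sqr_ge0 ?fb.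
Qed.

(** * Positive definite matrices *)

Lemma posdefmx_unit (R : realFieldType) n (A : 'M[R]_n) :
  posdefmx A -> A \in unitmx.
Proof.
move=> [sA pA]; rewrite -row_free_unit; apply: inj_row_free => v v0.
apply/eqP; apply: contraT => vn0.
have := pA v^T; rewrite -(inj_eq trmx_inj) trmxK trmx0 => /(_ vn0).
by rewrite v0 mul0mx mxE ltxx.
Qed.

Lemma posdefmx_invmx (R : realFieldType) n (A : 'M[R]_n) :
  posdefmx A -> posdefmx (invmx A).
Proof.
move=> pdA; have uA := posdefmx_unit pdA; case: pdA => sA pA.
split=> [|x x0]; first by rewrite trmx_inv sA.
(* The form of [invmx A] at [x] is the form of [A] at [invmx A *m x]. *)
have y0 : invmx A *m x != 0.
  by apply: contraNneq x0 => y0; rewrite -[x](mulKVmx uA) y0 mulmx0.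
have := pA _ y0; rewrite trmx_mul trmx_inv sA.
by rewrite -(mulmxA (x^T *m invmx A)) (mulKVmx uA).
Qed.

Lemma posdefmx_qf (R : realFieldType) n (A : 'M[R]_n) (v : 'rV[R]_n) :
  posdefmx A -> 0 <= (v *m A *m v^T) 0 0 ?= iff (v == 0).
Proof.
move=> [_ pA]; have [->|v0] := eqVneq v 0.
  by rewrite !mul0mx mxE; apply/leifP.
have : 0 < (v *m A *m v^T) 0 0.
  by rewrite -{1}[v]trmxK pA // -(inj_eq trmx_inj) trmxK trmx0.
by move=> lt0; apply/leifP.
Qed.

(** * Quadratic forms of the Laplacian and of the resistance matrix *)

Section Laplacian.

Variables (R : realFieldType) (n s : nat).
Variables (e : rel 'I_n) (W : 'I_n -> 'I_n -> 'M[R]_s).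
Hypothesis e_sym : symmetric e.
Hypothesis W_sym : forall i j, e i j -> W i j = W j i.
Hypothesis e_irr : irreflexive e.
Hypothesis W_posdef : forall i j, e i j -> posdefmx (W i j).
Hypothesis e_conn : connected_graph e.

(** The transpose of [E] in the overview, as vectors are rows from here on. *)
Definition block_ones : 'M[R]_(s, \sum_(i < n) s) := \mxrow_(i < n) 1%:M.

Let L := laplacian e W.

Lemma mul_laplacian m (x : 'I_n -> 'M[R]_(m, s)) :
  (\mxrow_i x i) *m L =
  \mxrow_j \sum_(k | e j k) (x j - x k) *m invmx (W j k).
Proof.
rewrite /L /laplacian mul_mxrow_mxblock; apply: eq_mxrow => j.
rewrite (bigD1 j) //= eqxx mulmx_sumr.
under [RHS]eq_bigr do rewrite mulmxBl.
rewrite [RHS]sumrB; congr (_ + _).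
(* Non-neighbours contribute 0, and irreflexivity lets the condition [k != j] be absorbed into
   [e j k]. *)
rewrite (bigID (e j)) /= addrC big1 ?add0r.
  rewrite -sumrN; apply: eq_big => [k|k /andP[/negPf kj ejk]].
    by have [->|] := eqVneq k j; rewrite ?e_irr.
  by rewrite kj e_sym ejk mulmxN W_sym // e_sym.
by move=> k /andP[/negPf kj /negPf ejk]; rewrite kj e_sym ejk mulmx0.
Qed.

Lemma block_ones_laplacian : block_ones *m L = 0.
Proof.
rewrite mul_laplacian -[RHS]mxrow0; apply: eq_mxrow => j.
by rewrite big1 // => k _; rewrite subrr mul0mx.
Qed.

Lemma laplacian_sym : L^T = L.
Proof.
have sV i j : e i j -> (invmx (W i j))^T = invmx (W i j).
  by move=> /W_posdef[sW _]; rewrite trmx_inv sW.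
rewrite /L /laplacian tr_mxblock; apply: eq_mxblock => i j.
rewrite eq_sym; have [->|_] := eqVneq i j.
  by rewrite raddf_sum; apply: eq_bigr => k /sV.
rewrite e_sym; case: ifP => [eij|_]; last by rewrite trmx0.
by rewrite raddfN /= sV 1?e_sym // (W_sym eij).
Qed.

(** The factor 2 appears because each edge is summed in both orientations: adding the sum of [f i j]
    to its swapped copy completes the right-hand factor [x i] to [x i - x j]. *)
Lemma laplacian_qf (x : 'I_n -> 'rV[R]_s) :
  2 * ((\mxrow_i x i) *m L *m (\mxrow_i x i)^T) 0 0 =
  \sum_i \sum_(j | e i j) ((x i - x j) *m invmx (W i j) *m (x i - x j)^T) 0 0.
Proof.
pose f i j := ((x i - x j) *m invmx (W i j) *m (x i)^T) 0 0.
have -> : ((\mxrow_i x i) *m L *m (\mxrow_i x i)^T) 0 0 =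
    \sum_i \sum_(j | e i j) f i j.
  rewrite mul_laplacian tr_mxrow mul_mxrow_mxcol summxE.
  by apply: eq_bigr => i _; rewrite mulmx_suml summxE.
have swap : \sum_i \sum_(j | e i j) f i j = \sum_i \sum_(j | e i j) f j i.
  rewrite (exchange_big_dep predT) //=; apply: eq_bigr => i _.
  by apply: eq_bigl => j; rewrite e_sym.
rewrite mulr_natl mulr2n {2}swap -big_split; apply: eq_bigr => i _ /=.
rewrite -big_split; apply: eq_bigr => j eij /=.
rewrite /f -(W_sym eij) linearB /= mulmxBr [in RHS]mxE; congr (_ + _).
by rewrite -[x j - x i]opprB !mulNmx !mxE.
Qed.

Lemma laplacian_psd (x : 'rV[R]_(\sum_(i < n) s)) :
  0 <= (x *m L *m x^T) 0 0.
Proof.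
rewrite -(pmulr_rge0 _ (ltr0n R 2)) -[x]submxrowK laplacian_qf.
apply: sumr_ge0 => i _; apply: sumr_ge0 => j eij.
exact: posdefmx_qf (posdefmx_invmx (W_posdef eij)).
Qed.

(** A vanishing sum of nonnegative edge terms has all terms zero, so blocks agree across each edge,
    hence along paths, hence everywhere by connectedness. *)
Lemma laplacian_qf_eq0 (x : 'rV[R]_(\sum_(i < n) s)) :
  (x *m L *m x^T) 0 0 = 0 -> exists y : 'rV_s, x = y *m block_ones.
Proof.
move=> qf0; pose z i := submxrow x i.
have qf_ge0 i j : e i j ->
    0 <= ((z i - z j) *m invmx (W i j) *m (z i - z j)^T) 0 0 ?= iff (z i - z j == 0).
  by move=> eij; apply/posdefmx_qf/posdefmx_invmx/W_posdef.
have z_edge i j : e i j -> z i = z j.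
  move=> eij; have := laplacian_qf z; rewrite submxrowK qf0 mulr0 => /esym/eqP.
  rewrite psumr_eq0 => [/allP/(_ i (mem_index_enum i)) | k _]; last first.
    by apply: sumr_ge0 => l /qf_ge0[].
  rewrite psumr_eq0 => [/allP/(_ j (mem_index_enum j)) | l /qf_ge0[] //].
  by rewrite eij /= eq_sym (qf_ge0 i j eij) subr_eq0 => /eqP.
have z_const i j : z i = z j.
  have /connectP[p] := e_conn i j.
  by elim: p i => [i _ -> //|k p IHp i /= /andP[/z_edge -> /IHp]].
(* The common block is read off at any vertex; without vertices [x] is empty and 0 serves. *)
have [i _|n0] := pickP (fun _ : 'I_n => true).
  exists (z i); rewrite -[LHS]submxrowK mul_mxrow; apply: eq_mxrow => j.
  by rewrite mulmx1; apply: z_const.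
by exists 0; apply/mxrowP => i; have := n0 i.
Qed.

Lemma block_ones_inj (y : 'rV[R]_s) : (0 < n)%N -> y *m block_ones = 0 -> y = 0.
Proof.
move=> n_gt0; rewrite mul_mxrow -mxrow0 => /eq_mxrowP/(_ (Ordinal n_gt0)).
by rewrite mulmx1.
Qed.

Lemma resistance_qf (x : 'rV[R]_(\sum_(i < n) s)) :
  block_ones *m x^T = 0 ->
  (x *m resistance e W *m x^T) 0 0 = - (2 * (x *m mpinv L *m x^T) 0 0).
Proof.
move=> ox; pose K i := submxblock (mpinv L) i i.
(* Here [\mxcol_i K i] is the [D] of the overview and [\mxrow_j K j] stands for [D^T]; both rank
   terms die against [x]. *)
have -> : resistance e W = \mxcol_i K i *m block_ones
    + block_ones^T *m \mxrow_j K j - mpinv L *+ 2.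
  rewrite -[mpinv L]submxblockK tr_mxrow !mul_mxcol_mxrow.
  rewrite mulr2n -!mxblockD -mxblockB; apply: eq_mxblock => i j.
  by rewrite trmx1 mulmx1 mul1mx mulr2n.
have xo : x *m block_ones^T = 0 by rewrite -[LHS]trmxK trmx_mul trmxK ox trmx0.
rewrite mulmxBr mulmxDr mulmxA mulmxBl mulmxDl -(mulmxA _ block_ones) ox.
rewrite mulmx0 add0r mulmxA xo !mul0mx add0r.
by rewrite mulr2n mulmxDr mulmxDl !mxE mulr_natl mulr2n.
Qed.

End Laplacian.

(** * Spectra of pseudoinverses and of positive semidefinite matrices *)

Lemma mpinv_spectral (R : realFieldType) n (P : 'M[R]_n) (d : 'rV[R]_n) :
  P *m P^T = 1%:M ->
  mpinv (P^T *m diag_mx d *m P) = P^T *m diag_mx (\row_i (d 0 i)^-1) *m P.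
Proof.
move=> PP; apply: is_mpinv_uniq; first exact: mpinvP.
have conjM (a b : 'rV[R]_n) : (P^T *m diag_mx a *m P) *m (P^T *m diag_mx b *m P) =
    P^T *m diag_mx (\row_i (a 0 i * b 0 i)) *m P.
  by rewrite -mulmx_diag !mulmxA -(mulmxA _ P) PP mulmx1.
have conjT (a : 'rV[R]_n) : (P^T *m diag_mx a *m P)^T = P^T *m diag_mx a *m P.
  by rewrite !trmx_mul trmxK tr_diag_mx mulmxA.
(* The convention [0^-1 = 0] gives zero eigenvalues the inverse that the Penrose equations
   require. *)
split; rewrite !conjM ?conjT //; congr (_ *m diag_mx _ *m _);
  apply/rowP => i; rewrite !mxE.
  by have [->|d0] := eqVneq (d 0 i) 0; rewrite ?mulr0 // divff ?mul1r.
by have [->|d0] := eqVneq (d 0 i) 0; rewrite ?invr0 ?mulr0 // mulVf ?mul1r.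
Qed.

Section PsdSpectrum.

Variables (R : realFieldType) (N s : nat).
Variables (P : 'M[R]_N) (d : 'rV[R]_N) (B : 'M[R]_(s, N)).
Let L := P^T *m diag_mx d *m P.
Hypothesis PP : P *m P^T = 1%:M.
Hypothesis BL : B *m L = 0.

(** In eigenbasis coordinates [B *m L = 0] says that [d 0 i] kills column [i] of [B *m P^T]. *)
Lemma ker_coord i : d 0 i != 0 -> forall k, (B *m P^T) k i = 0.
Proof.
move=> di k; have : B *m P^T *m diag_mx d = 0.
  by rewrite -[LHS]mulmx1 -PP !mulmxA -(mulmxA _ P^T) -(mulmxA B) BL mul0mx.
rewrite mul_mx_diag => /matrixP/(_ k i)/eqP.
by rewrite !mxE mulf_eq0 (negPf di) orbF => /eqP.
Qed.

(** In the eigenbasis, [x] and the rows of [B] have disjoint supports. *)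
Lemma supported_orthogonal_ker (x : 'rV[R]_N) :
  (forall i, d 0 i = 0 -> (x *m P^T) 0 i = 0) -> B *m x^T = 0.
Proof.
move=> x0; have -> : B *m x^T = (B *m P^T) *m (x *m P^T)^T.
  by rewrite trmx_mul trmxK mulmxA -(mulmxA B) (mulmx1C PP) mulmx1.
apply/matrixP => k l; rewrite !mxE big1 // => i _; rewrite ord1.
rewrite [(_ *m _)^T _ _]mxE.
have [/x0 -> | di] := eqVneq (d 0 i) 0; first by rewrite mulr0.
by rewrite (ker_coord di) mul0r.
Qed.

Hypothesis L_psd : forall x : 'rV_N, 0 <= (x *m L *m x^T) 0 0.
Hypothesis L_ker : forall x : 'rV_N,
  (x *m L *m x^T) 0 0 = 0 -> exists y : 'rV_s, x = y *m B.
Hypothesis B_inj : forall y : 'rV_s, y *m B = 0 -> y = 0.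
Hypothesis d_desc : forall i j : 'I_N, (i <= j)%N -> d 0 j <= d 0 i.

Lemma psd_spectrum_ge0 i : 0 <= d 0 i.
Proof.
have := L_psd (row i P); rewrite qform_diag -row_mul PP.
rewrite (bigD1 i) //= big1 ?addr0 => [|j ji]; rewrite !mxE ?eqxx ?expr1n ?mulr1 //.
by rewrite eq_sym (negPf ji) expr0n mulr0.
Qed.

(** Otherwise [d] vanishes from [i] on, and [i + s < N] conditions leave a nonzero [x] in the kernel
    of the form that is orthogonal to the rows of [B]. But [x] is also a combination of these rows,
    hence orthogonal to itself. *)
Lemma psd_spectrum_gt0 (i : 'I_N) : (i < N - s)%N -> 0 < d 0 i.
Proof.
move=> ltis; rewrite lt_neqAle psd_spectrum_ge0 andbT eq_sym.
apply: contraTneq ltis => di0; rewrite -leqNgt leqNgt; apply/negP => ltis.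
have d0 (j : 'I_N) : (i <= j)%N -> d 0 j = 0.
  by move=> ij; apply/le_anti; rewrite psd_spectrum_ge0 -di0 d_desc.
have ltN : (#|[set j : 'I_N | (j < i)%N]| + #|[set: 'I_s]| < N)%N.
  by rewrite (card_ord_lt (ltnW (ltn_ord i))) cardsT card_ord addnC -ltn_subRL.
have [x x0 [xI xB]] := exists_vanishing P^T B^T ltN.
have qf0 : (x *m L *m x^T) 0 0 = 0.
  rewrite qform_diag big1 // => j _; have [ji|ij] := ltnP j i.
    by rewrite xI ?inE // expr0n mulr0.
  by rewrite d0 // mul0r.
have [y xE] := L_ker qf0; move: x0; rewrite -mxdot_eq0 {2}xE trmx_mul mulmxA.
suff -> : x *m B^T = 0 by rewrite mul0mx mxE eqxx.
by apply/rowP => j; rewrite xB ?inE // mxE.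
Qed.

(** Otherwise [d] is nonzero up to [i], so the [s] rows of [B *m P^T] live on the fewer than [s]
    columns after [i] and are dependent, against [B_inj]. *)
Lemma psd_spectrum_eq0 (i : 'I_N) : (N - s <= i)%N -> d 0 i = 0.
Proof.
move=> leis; apply/eqP; apply: contraT => di0.
have dn0 (j : 'I_N) : (j <= i)%N -> d 0 j != 0.
  move=> ji; rewrite gt_eqF // (lt_le_trans _ (d_desc ji)) //.
  by rewrite lt_neqAle eq_sym di0 psd_spectrum_ge0.
have lts : (#|[set j : 'I_N | (i.+1 <= j)%N]| + #|@set0 'I_0| < s)%N.
  rewrite card_ord_ge // cards0 addn0; have := ltn_ord i; lia.
have [y y0 [yI _]] := exists_vanishing (B *m P^T) 0 lts.
have yBP : y *m (B *m P^T) = 0.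
  apply/rowP => j; rewrite [RHS]mxE; have [ij|ji] := ltnP i j.
    by rewrite yI ?inE.
  by rewrite mxE big1 // => k _; rewrite ker_coord ?mulr0 ?dn0.
move: y0; rewrite (@B_inj y) ?eqxx //.
by rewrite -[LHS]mulmx1 -(mulmx1C PP) !mulmxA -(mulmxA y) yBP mul0mx.
Qed.

End PsdSpectrum.

(** * Interlacing of the two spectra *)

Lemma resistance_sym (R : realFieldType) n s (e : rel 'I_n)
    (W : 'I_n -> 'I_n -> 'M[R]_s) :
  (mpinv (laplacian e W))^T = mpinv (laplacian e W) ->
  (resistance e W)^T = resistance e W.
Proof.
move=> sK; rewrite /resistance tr_mxblock; apply: eq_mxblock => i j.
rewrite linearB linearD /= [in LHS]mulr2n linearD /= !tr_submxblock sK -mulr2n.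
by rewrite [X in X - _]addrC.
Qed.

Lemma eigenvalues_desc_spectral (R : rcfType) n (A : 'M[R]_n) (mu : seq R) :
    A^T = A -> eigenvalues_desc A mu ->
  exists2 P : 'M[R]_n, P *m P^T = 1%:M
    & A = P^T *m diag_mx (\row_i mu`_i) *m P.
Proof. by move=> sA [_ chA]; apply: symmetric_spectral. Qed.

Lemma eigenvalues_desc_homo (R : realFieldType) n (A : 'M[R]_n) (mu : seq R) :
    eigenvalues_desc A mu ->
  forall i j, (i <= j < n)%N -> mu`_j <= mu`_i.
Proof.
move=> [srt chA] i j /andP[ij jn].
have sz : size mu = n.
  by have := size_char_poly A; rewrite chA size_prod_XsubC => -[].
apply: (sorted_leq_nth ge_trans ge_refl 0 srt); rewrite ?inE ?sz //. 
exact: leq_ltn_trans jn.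
Qed.

Unset Implicit Arguments.
Set Strict Implicit.

(* Eigenvalues are indexed from 0: mu`_i is the (i+1)-st largest one. *)
Theorem theorem4p4 (R : realType) (n s : nat)
    (e : rel 'I_n) (W : 'I_n -> 'I_n -> 'M[R]_s) (mu lambda : seq R)
    (e_sym : symmetric e) (e_irr : irreflexive e)
    (e_conn : connected_graph e)
    (W_sym : forall i j, e i j -> W i j = W j i)
    (W_posdef : forall i j, e i j -> posdefmx (W i j))
    (mu_eig : eigenvalues_desc (resistance e W) mu)
    (lambda_eig : eigenvalues_desc (laplacian e W) lambda) :
  [/\ forall i, (i < n * s - s)%N -> 0 < lambda`_i,
      forall i, (n * s - s <= i < n * s)%N -> lambda`_i = 0
    & forall i, (i < n * s - s)%N ->
        mu`_(s + i) <= - (2 / lambda`_i) <= mu`_i].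
Proof.
have NE : (\sum_(i < n) s = n * s)%N by rewrite sum_nat_const card_ord.
have sL : (laplacian e W)^T = laplacian e W by apply: laplacian_sym.
have [P PP LE] := eigenvalues_desc_spectral sL lambda_eig.
have sK : (mpinv (laplacian e W))^T = mpinv (laplacian e W).
  by rewrite LE mpinv_spectral // !trmx_mul trmxK tr_diag_mx mulmxA.
have [Q QQ RE] := eigenvalues_desc_spectral (resistance_sym sK) mu_eig.
have mu_desc := eigenvalues_desc_homo mu_eig.
have la_desc := eigenvalues_desc_homo lambda_eig.
move: mu_desc la_desc; rewrite NE => mu_desc la_desc.
pose d : 'rV[R]_(\sum_(i < n) s) := \row_i lambda`_i.
have d_desc (i j : 'I_(\sum_(i < n) s)) : (i <= j)%N -> d 0 j <= d 0 i.
  by move=> ij; rewrite !mxE la_desc // ij -NE ltn_ord.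
have BL : block_ones R n s *m (P^T *m diag_mx d *m P) = 0.
  by rewrite -LE block_ones_laplacian.
have psd (x : 'rV_(\sum_(i < n) s)) : 0 <= (x *m (P^T *m diag_mx d *m P) *m x^T) 0 0.
  by rewrite -LE laplacian_psd.
have ker (x : 'rV_(\sum_(i < n) s)) : (x *m (P^T *m diag_mx d *m P) *m x^T) 0 0 = 0 ->
    exists y : 'rV_s, x = y *m block_ones R n s.
  by rewrite -LE; apply: laplacian_qf_eq0.
have la_gt0 i : (i < n * s - s)%N -> 0 < lambda`_i.
  move=> ltis; have ltiN : (i < \sum_(i < n) s)%N by rewrite NE; lia.
  have := psd_spectrum_gt0 PP psd ker d_desc (i := Ordinal ltiN).
  by rewrite mxE /= NE; apply.
have la_eq0 i : (n * s - s <= i < n * s)%N -> lambda`_i = 0.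
  case/andP => leis ltiN; rewrite -NE in ltiN.
  have n_gt0 : (0 < n)%N by move: ltiN; rewrite NE; case: (n).
  have := psd_spectrum_eq0 PP BL psd
    (fun y => block_ones_inj n_gt0) d_desc (i := Ordinal ltiN).
  by rewrite mxE /= NE; apply.
split=> // i ltis.
(* The spectrum of [- 2 L^+] in the basis [P]; its last [s] entries are 0, again by [0^-1 = 0]. *)
pose th : 'rV[R]_(\sum_(i < n) s) := \row_i - (2 / lambda`_i).
have qfE (x : 'rV_(\sum_(i < n) s)) :
    (forall j : 'I_(\sum_(i < n) s), (n * s - s <= j)%N -> (x *m P^T) 0 j = 0) ->
  (x *m (Q^T *m diag_mx (\row_j mu`_j) *m Q) *m x^T) 0 0 =
  (x *m (P^T *m diag_mx th *m P) *m x^T) 0 0.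
  move=> xP; rewrite -RE resistance_qf.
    rewrite LE mpinv_spectral // !qform_diag mulr_sumr -sumrN.
    by apply: eq_bigr => j _; rewrite !mxE mulrA mulNr.
  apply: (supported_orthogonal_ker (P := P) (d := d)) => // j; rewrite mxE => laj.
  by apply: xP; rewrite leqNgt; apply/negP => /la_gt0; rewrite laj ltxx.
have ltiN : (s + i < n * s)%N by lia.
apply/andP; split.
  (* [I] costs [n * s - s - i - 1] conditions and [J] at most [i + s], the last [s] of them
     confining [x] to the complement of the kernel. The total is below [n * s]. *)
  pose I := [set j : 'I_(\sum_(i < n) s) | (s + i < j)%N].
  pose J := [set j : 'I_(\sum_(i < n) s) | (j < i)%N]
    :|: [set j : 'I_(\sum_(i < n) s) | (n * s - s <= j)%N].
  apply: (@spectral_compare _ _ Q P (\row_j mu`_j) th I J) => //.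
  - have lecJ : (#|J| <= i + s)%N.
      rewrite (leq_trans (leq_card_setU _ _)) // card_ord_lt ?card_ord_ge ?NE; lia.
    rewrite card_ord_ge ?NE //; move: #|J| lecJ => k; rewrite NE; lia.
  - by move=> j; rewrite inE -leqNgt mxE => ji; apply: mu_desc; rewrite ji.
  - move=> j; rewrite !inE negb_or -leqNgt -ltnNge mxE => /andP[ij js].
    rewrite lerN2 ler_pM2l ?ltr0n // lef_pV2 ?posrE ?la_gt0 // la_desc // ij.
    by rewrite -NE ltn_ord.
  - by move=> x _ xJ; rewrite qfE // => j js; apply: xJ; rewrite !inE js orbT.
(* Since [i < n * s - s], the indices beyond [i] already include those of the kernel, so no shift by
   [s] arises: the count is [(n * s - i - 1) + i]. *)
pose I := [set j : 'I_(\sum_(i < n) s) | (i < j)%N].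
pose J := [set j : 'I_(\sum_(i < n) s) | (j < i)%N].
apply: (@spectral_compare _ _ P Q th (\row_j mu`_j) I J) => //.
- by rewrite card_ord_lt ?card_ord_ge ?NE; lia.
- move=> j; rewrite inE -leqNgt mxE => ji.
  have ltjs := leq_ltn_trans ji ltis.
  rewrite lerN2 ler_pM2l ?ltr0n // lef_pV2 ?posrE ?la_gt0 // la_desc // ji; lia.
- by move=> j; rewrite inE -leqNgt mxE => ij; rewrite mu_desc // ij -NE ltn_ord.
- move=> x xI _; rewrite qfE // => j js; apply: xI; rewrite inE.
  exact: leq_trans js.
Qed.
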